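(* Let $\mathcal P$ be an additive induced-hereditary hypergraph property and let $\mathcal P=\mathcal Q_1\circ\cdots\circ\mathcal Q_m$ be a factorisation of $\mathcal P$ into indecomposable additive induced-hereditary properties $\mathcal Q_1,\dots,\mathcal Q_m$. Then $m=dec(\mathcal P)$.
   Context: All hypergraphs are finite, without loops or multiple edges; each edge is an ordered tuple $(v_1,\dots,v_r;c)$ of $r\ge 2$ distinct vertices together with a colour $c$, and isomorphisms must preserve the order and colour of edges. For $U\subseteq V(H)$, $H[U]$ is the hypergraph on $U$ whose edges are those edges of $H$ all of whose vertices lie in $U$; $G\le H$ means $G$ is isomorphic to $H[U]$ for some $U\subseteq V(H)$. A property is a nonempty isomorphism-closed class of hypergraphs; the null hypergraph $K_0$ is regarded as belonging to every property. A property is induced-hereditary if closed under $\le$, and additive if closed under disjoint unions. For properties $\mathcal P_1,\dots,\mathcal P_n$, a $(\mathcal P_1,\dots,\mathcal P_n)$-partition of $H$ is a partition $(V_1,\dots,V_n)$ of $V(H)$ into possibly empty parts with $H[V_i]\in\mathcal P_i$; $\mathcal P_1\circ\cdots\circ\mathcal P_n$ is the class of hypergraphs having such a partition. For hypergraphs $G_1,\dots,G_n$ on pairwise disjoint vertex sets, $G_1*\cdots*G_n$ is the set of all hypergraphs $H$ with $V(H)=\bigcup_i V(G_i)$ and $H[V(G_i)]=G_i$ for all $i$. $kG$ is the disjoint union of $k$ copies of $G$; $K_1$ is the one-vertex hypergraph. A $\mathcal P$-decomposition of $G$ with $n$ parts is a partition $(V_1,\dots,V_n)$ of $V(G)$ into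 nonempty sets such that $kG[V_1]*\cdots*kG[V_n]\subseteq\mathcal P$ for every positive integer $k$. $dec_{\mathcal P}(G)$ is the maximum number of parts in a $\mathcal P$-decomposition of $G$ ($0$ if $G\notin\mathcal P$). $G$ is $\mathcal P$-strict if $G\in\mathcal P$ but $G*K_1\not\subseteq\mathcal P$. $dec(\mathcal P)=\min\{dec_{\mathcal P}(G): G\text{ is }\mathcal P\text{-strict}\}$, and $\mathcal P$ is indecomposable if $dec(\mathcal P)=1$. *)

(* Defs.v *)
From HB Require Import structures.
From mathcomp Require Import all_boot all_classical.

Set Implicit Arguments.
Unset Strict Implicit.
Unset Printing Implicit Defensive.

Local Open Scope classical_set_scope.

(* Edges form a set, so "no multiple edges" means that no pair (tuple, colour)
   is repeated.  The colour type C need not be finite, hence [edges_finite]. *)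
Record hypergraph (C : Type) := Hypergraph {
  vert : finType;
  edges : set (seq vert * C);
  edges_finite : finite_set edges;
  edges_wf : forall e, edges e -> 2 <= size e.1 /\ uniq e.1
}.
Arguments vert {C} h.
Arguments edges {C} h e.
Arguments edges_finite {C} h.
Arguments edges_wf {C} h e.

Definition map_edge (C V W : Type) (f : V -> W) (e : seq V * C) : seq W * C :=
  (map f e.1, e.2).

Lemma map_edge_inj (C V W : Type) (f : V -> W) :
  injective f -> injective (@map_edge C V W f).
Proof. by move=> fI [s c] [t d] [/(inj_map fI) -> ->]. Qed.

Definition iso (C : Type) (G H : hypergraph C) : Prop :=
  exists f : vert G -> vert H,
    bijective f /\ forall e, edges G e <-> edges H (map_edge f e).

Section Constructions.
Variable C : Type.

Section Induced.
Variables (H : hypergraph C) (U : {set vert H}).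

Definition induced_edges : set (seq {x : vert H | x \in U} * C) :=
  map_edge (val : {x : vert H | x \in U} -> vert H) @^-1` edges H.

Lemma induced_finite : finite_set induced_edges.
Proof.
apply: finite_preimage (edges_finite H).
by move=> e1 e2 _ _; apply/map_edge_inj/val_inj.
Qed.

Lemma induced_wf e : induced_edges e -> 2 <= size e.1 /\ uniq e.1.
Proof.
by case/edges_wf; rewrite /= size_map map_inj_uniq //; apply: val_inj.
Qed.

Definition induced : hypergraph C := Hypergraph induced_finite induced_wf.

End Induced.

Section DisjointUnion.
Variables (I : finType) (G : I -> hypergraph C).

Definition dunion_edges : set (seq {i : I & vert (G i)} * C) :=
  \bigcup_(i in [set: I]) (map_edge (Tagged (fun i => vert (G i))) @` edges (G i)).

Lemma dunion_finite : finite_set dunion_edges.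
Proof.
apply: bigcup_finite => [|i _]; first exact: finite_finset.
exact/finite_image/edges_finite.
Qed.

Lemma dunion_wf e : dunion_edges e -> 2 <= size e.1 /\ uniq e.1.
Proof.
case=> i _ [e' /edges_wf [sz un] <-]; rewrite /= size_map map_inj_uniq //.
exact: eq_from_Tagged.
Qed.

Definition dunion : hypergraph C := Hypergraph dunion_finite dunion_wf.

End DisjointUnion.

Section Edgeless.
Variable V : finType.

Lemma edgeless_wf (e : seq V * C) : set0 e -> 2 <= size e.1 /\ uniq e.1.
Proof. by []. Qed.

Definition edgeless : hypergraph C :=
  Hypergraph (finite_set0 (seq V * C)%type) edgeless_wf.

End Edgeless.

Definition K0 : hypergraph C := edgeless void.
Definition K1 : hypergraph C := edgeless unit.

Definition copies (k : nat) (G : hypergraph C) : hypergraph C :=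
  dunion (fun _ : 'I_k => G).

Definition induced_sub (G H : hypergraph C) : Prop :=
  exists U : {set vert H}, iso G (induced U).

(* A family of pairwise disjoint, possibly empty, sets covering V. *)
Definition is_partition (V I : finType) (A : I -> {set V}) : Prop :=
  (forall x, exists i, x \in A i) /\
  (forall i j x, x \in A i -> x \in A j -> i = j).

(* Not [set (hypergraph C)], which is a universe inconsistency. *)
Definition hclass := hypergraph C -> Prop.

Definition hclass_sub (P Q : hclass) : Prop := forall G, P G -> Q G.

Definition is_property (P : hclass) : Prop :=
  P K0 /\ (forall G H, iso G H -> P G -> P H).

Definition induced_hereditary (P : hclass) : Prop :=
  forall G H, induced_sub G H -> P H -> P G.

Definition additive (P : hclass) : Prop :=
  forall (I : finType) (G : I -> hypergraph C),
    (forall i, P (G i)) -> P (dunion G).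

Definition circ (n : nat) (P : 'I_n -> hclass) : hclass :=
  fun H => exists A : 'I_n -> {set vert H},
    is_partition A /\ forall i, P i (induced (A i)).

(* The class G_1 * ... * G_n, closed under isomorphism: vertex sets are types,
   so the (disjoint) V(G_i) are located inside V(H) by the partition A. *)
Definition star (I : finType) (G : I -> hypergraph C) : hclass :=
  fun H => exists A : I -> {set vert H},
    is_partition A /\ forall i, iso (induced (A i)) (G i).

Definition star2 (G H : hypergraph C) : hclass :=
  star (fun b : bool => if b then G else H).

Definition is_decomposition (P : hclass) (G : hypergraph C)
    (n : nat) (A : 'I_n -> {set vert G}) : Prop :=
  [/\ is_partition A,
      forall i, A i != finset.set0 &
      forall k, 0 < k -> hclass_sub (star (fun i => copies k (induced (A i)))) P].

(* A partition into n nonempty parts has n <= #|V(G)|, so bounding the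
   maximum by #|V(G)| loses nothing. *)
Definition dec_at (P : hclass) (G : hypergraph C) : nat :=
  if `[< P G >] then
    \max_(n < #|vert G|.+1
        | `[< exists A : 'I_n -> {set vert G}, is_decomposition P A >]) n
  else 0.

Definition strict (P : hclass) (G : hypergraph C) : Prop :=
  P G /\ ~ hclass_sub (star2 G K1) P.

(* [is_dec P d] is "dec(P) = d": d is the minimum of [dec_at P] over the
   P-strict hypergraphs.  If there are none, dec(P) is undefined and no d
   satisfies [is_dec P d]. *)
Definition is_dec (P : hclass) (d : nat) : Prop :=
  (exists2 G, strict P G & dec_at P G = d) /\
  (forall G, strict P G -> d <= dec_at P G).

Definition indecomposable (P : hclass) : Prop := is_dec P 1.

End Constructions.

(* Main.v *)
(* That m <= dec(P) holds because in a strict hypergraph all parts of a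
   (Q_1, ..., Q_m)-partition are nonempty, and these parts form a
   P-decomposition.

   For the converse let G0 be strict with n = dec_P(G0) = dec(P).  Every
   hypergraph of P containing G0 has a decomposition into n parts, and none
   into more.  Two Ramsey arguments in generic members of kG[V_1] * ... *
   kG[V_n] show that (a) the parts of a decomposition V are grouped into m
   classes by some s : [n] -> [m] such that the parts of class i form a
   Q_i-decomposition, and (b) every decomposition of a suitable larger
   hypergraph refines a prescribed (Q_1, ..., Q_m)-partition and restricts to V
   on some copy of G.  Choose (G, V) containing G0 with the fewest groupings s
   as in (a), fix one, and use (b) to add to its class i a Q_i-strict F_i with
   dec_{Q_i}(F_i) = 1.  By minimality s is still a grouping, so class i is a
   Q_i-decomposition of a hypergraph containing F_i and has at most one part.
   Hence s is injective and n <= m. *)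
Require Import Defs.
From mathcomp Require Import all_boot all_classical.

Set Implicit Arguments.
Unset Strict Implicit.
Unset Printing Implicit Defensive.

Local Open Scope classical_set_scope.

(** * Induced embeddings *)

Section Embeddings.
Variable C : Type.
Implicit Types G H : hypergraph C.

(** This is [induced_sub G H] with its map made explicit, so that embeddings compose and labellings
    are pulled back without subset types. *)
Definition embed G H (f : vert G -> vert H) : Prop :=
  injective f /\ forall e, edges G e <-> edges H (map_edge f e).

Lemma map_edge_comp (U V W : Type) (g : V -> W) (f : U -> V) (e : seq U * C) :
  map_edge g (map_edge f e) = map_edge (g \o f) e.
Proof. by rewrite /map_edge /= map_comp. Qed.

Lemma eq_in_map_edge (V : eqType) (W : Type) (f g : V -> W) (e : seq V * C) :
  {in e.1, f =1 g} -> map_edge f e = map_edge g e.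
Proof. by move=> fg; rewrite /map_edge; congr pair; apply/eq_in_map. Qed.

Lemma map_edge_id (V : Type) (e : seq V * C) : map_edge id e = e.
Proof. by case: e => s c; rewrite /map_edge map_id. Qed.

Lemma embed_id G : embed (id : vert G -> vert G).
Proof. by split=> // e; rewrite map_edge_id. Qed.

Lemma embed_comp G H K (f : vert G -> vert H) (g : vert H -> vert K) :
  embed f -> embed g -> embed (g \o f).
Proof.
move=> [fI fE] [gI gE]; split; first exact: inj_comp.
by move=> e; rewrite fE gE map_edge_comp.
Qed.

Lemma embed_induced H (U : {set vert H}) :
  embed (val : vert (induced U) -> vert H).
Proof. by split; first exact: val_inj. Qed.

Lemma iso_embed G H : iso G H -> exists2 f : vert G -> vert H, embed f & bijective f.
Proof. by case=> f [fB fE]; exists f => //; split=> //; apply: bij_inj. Qed.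

Lemma embed_bij_iso G H (f : vert G -> vert H) : embed f -> bijective f -> iso G H.
Proof. by move=> [_ fE] fB; exists f. Qed.

Lemma iso_sym G H : iso G H -> iso H G.
Proof.
case=> f [[g fK gK] fE]; exists g; split; first by exists f.
move=> e; rewrite fE map_edge_comp; have -> // : map_edge (f \o g) e = e.
by rewrite -[RHS]map_edge_id; apply: eq_in_map_edge => x _ /=.
Qed.

Lemma embed_induced_iso G H (f : vert G -> vert H) (U : {set vert H}) :
  embed f -> (forall y, y \in U <-> exists x, f x = y) -> iso G (induced U).
Proof.
move=> [fI fE] fU.
have fP x : f x \in U by apply/fU; exists x.
pose g x : vert (induced U) := exist _ (f x) (fP x).
apply: (@embed_bij_iso _ _ g).
  split=> [x y [] /fI //|e]; rewrite fE /= /induced_edges /= map_edge_comp.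
  exact: iff_refl.
have gs y : exists x, g x == y.
  by case/fU: (valP y) => x xy; exists x; apply/eqP/val_inj.
exists (fun y => xchoose (gs y)) => [x|y].
  have /eqP := xchooseP (gs (g x)); move/(congr1 val) => /=; exact: fI.
exact/eqP/(xchooseP (gs y)).
Qed.

Lemma induced_hereditary_embed (P : hclass C) G H (f : vert G -> vert H) :
  induced_hereditary P -> embed f -> P H -> P G.
Proof.
move=> Ph fE PH; apply: (Ph _ H) => //; exists [set f x | x in predT]%SET.
apply: (embed_induced_iso fE) => y; split=> [/imsetP[x _ ->]|[x <-]].
  by exists x.
by apply/imsetP; exists x.
Qed.

Lemma finite_uniq_seq (V : finType) : finite_set [set s : seq V | uniq s].
Proof.
suff : finite_set (\bigcup_(n in `I_(#|V|.+1)) (@tval n V @` [set: n.-tuple V])).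
  apply: sub_finite_set => s /= us; exists (size s).
    by rewrite /= ltnS -(card_uniqP us) max_card.
  by exists (in_tuple s).
by apply: bigcup_finite => // n _; apply: finite_image; apply: finite_finset.
Qed.

Lemma finite_edges (V : finType) (E : set (seq V * C)) (D : set C) :
  finite_set D -> (forall e, E e -> uniq e.1 /\ D e.2) -> finite_set E.
Proof.
move=> Df ED; apply: sub_finite_set (finite_setX (@finite_uniq_seq V) Df).
by move=> e /ED.
Qed.

Definition colours G : set C := snd @` edges G.

Lemma finite_colours G : finite_set (colours G).
Proof. exact/finite_image/edges_finite. Qed.

Lemma finite_coloursU G H : finite_set (colours G `|` colours H).
Proof. by rewrite finite_setU; split; apply: finite_colours. Qed.

Lemma edges_colours G e : edges G e -> colours G e.2.
Proof. by move=> Ge; exists e. Qed.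

Section OfEdges.
Variables (V : finType) (E : set (seq V * C)) (D : set C).
Hypotheses (Df : finite_set D)
  (Ewf : forall e, E e -> [/\ 2 <= size e.1, uniq e.1 & D e.2]).

Lemma of_edges_finite : finite_set E.
Proof. by apply: finite_edges Df _ => e /Ewf[]. Qed.

Lemma of_edges_wf e : E e -> 2 <= size e.1 /\ uniq e.1.
Proof. by case/Ewf. Qed.

(** Since [C] may be infinite, finiteness comes from a finite set [D] of colours, in use the colours
    of the hypergraphs being combined. *)
Definition of_edges : hypergraph C := Hypergraph of_edges_finite of_edges_wf.

End OfEdges.

Definition const_on (V : eqType) (W : Type) (f : V -> W) (s : seq V) : Prop :=
  forall x y, x \in s -> y \in s -> f x = f y.

Lemma const_on_map (U V : eqType) (W : Type) (f : U -> V) (g : V -> W) s :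
  const_on g (map f s) <-> const_on (g \o f) s.
Proof.
split=> [h x y xs ys|h _ _ /mapP[x xs ->] /mapP[y ys ->]]; last exact: h.
by apply: h; apply: map_f.
Qed.

Lemma sub_const_on (V : eqType) (W X : Type) (f : V -> W) (g : V -> X) s :
  (forall x y, f x = f y -> g x = g y) -> const_on f s -> const_on g s.
Proof. by move=> fg h x y xs ys; apply/fg/h. Qed.

End Embeddings.

(** * Blow-ups *)

Section Blowups.
Variable C : Type.
Implicit Types G H B : hypergraph C.

(* [B] is an induced subhypergraph of a member of kG[v = 1] * ... * kG[v = n]:
   [p] sends a vertex to the vertex of [G] of which it is a copy, and [l] is
   the number of the copy. *)
Definition blowup G (I : eqType) (v : vert G -> I) B (L : finType)
    (p : vert B -> vert G) (l : vert B -> L) : Prop :=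
  [/\ injective (fun y => (l y, p y)),
      forall e, const_on l e.1 -> const_on (v \o p) e.1 ->
        (edges B e <-> edges G (map_edge p e)) &
      forall e, edges B e -> const_on (v \o p) e.1 -> const_on l e.1].

Lemma blowup_id G (I : eqType) (v : vert G -> I) :
  blowup v (id : vert G -> vert G) (fun=> tt).
Proof.
by split=> [x y []|e _ _|e _ _ x y _ _] //; rewrite map_edge_id.
Qed.

Lemma blowup_embed G (I : eqType) (v : vert G -> I) B B' (L : finType)
    (p : vert B -> vert G) (l : vert B -> L) (f : vert B' -> vert B) :
  blowup v p l -> embed f -> blowup v (p \o f) (l \o f).
Proof.
move=> [pI pS pT] [fI fE]; split=> [x y /pI/fI //|e le ve|e Be ve].
- rewrite fE pS /= ?map_edge_comp //; exact/const_on_map.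
- by apply/const_on_map; apply: (pT (map_edge f e)); [exact/fE|exact/const_on_map].
Qed.

Lemma embed_blowup G H (I : eqType) (v : vert H -> I) (g : vert G -> vert H)
    B (L : finType) (p : vert B -> vert G) (l : vert B -> L) :
  embed g -> blowup (v \o g) p l -> blowup v (g \o p) l.
Proof.
move=> [gI gE] [pI pS pT]; split=> [x y [lxy /gI pxy]|e le ve|e Be ve].
- by apply: pI; rewrite lxy pxy.
- by rewrite pS // gE map_edge_comp.
- exact: pT.
Qed.

(** * Completing a blow-up and substituting one into another *)

Section Substitution.
Variables (G : hypergraph C) (I : finType) (v : vert G -> I).

Section Full.
Variables (B : hypergraph C) (L : finType) (p : vert B -> vert G) (l : vert B -> L).
Hypothesis pB : blowup v p l.

Let q y := (l y, p y).

(** [B] is enlarged to all [L] copies of every vertex. Edges meeting several classes come only from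
    [B]; inside one copy of a class the edges of [G] are restored. *)
Definition full_edges : set (seq (L * vert G) * C) := fun e =>
  (exists2 e', edges B e' & e = map_edge q e') \/
  [/\ const_on fst e.1, const_on (v \o snd) e.1 & edges G (map_edge snd e)].

Lemma full_edges_wf e : full_edges e ->
  [/\ 2 <= size e.1, uniq e.1 & (colours B `|` colours G) e.2].
Proof.
have [pI _ _] := pB; case=> [[e' Be' ->]|[_ _ Ge]].
  have [sz un] := edges_wf _ _ Be'.
  by rewrite /= size_map map_inj_uniq //; split=> //; left; apply: edges_colours.
have [] := edges_wf _ _ Ge; rewrite /= size_map => sz /map_uniq un.
by split=> //; right; apply: (edges_colours Ge).
Qed.

Definition full : hypergraph C :=
  of_edges (finite_coloursU B G) full_edges_wf.

Lemma embed_full : @embed C B full q.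
Proof.
have [pI pS _] := pB; split=> // e; split=> [Be|]; first by left; exists e.
case=> [[e' Be' /(map_edge_inj pI) -> //]|[/const_on_map le /const_on_map ve]].
by rewrite map_edge_comp => Ge; apply/pS.
Qed.

Lemma blowup_full : @blowup G I v full L snd fst.
Proof.
have [pI pS pT] := pB; split=> [[a b] [c d] [-> ->] //|e le ve|e].
  split=> [|Ge]; last by right.
  case=> [[e' Be' ee']|[] //]; move: le ve; rewrite {}ee' map_edge_comp.
  by move=> /const_on_map le /const_on_map ve; rewrite -pS.
case=> [[e' Be' ->]|[] //] /const_on_map ve.
by apply/const_on_map; apply: (pT e').
Qed.

End Full.

Section Subst.
Variables (L1 L2 : finType) (B1 B2 : hypergraph C).
Variables (p1 : vert B1 -> vert G) (l1 : vert B1 -> L1).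
Variables (p2 : vert B2 -> vert G) (l2 : vert B2 -> L2).
Hypotheses (pB1 : blowup v p1 l1) (pB2 : blowup v p2 l2).
Hypothesis q2 : forall l x, { y : vert B2 | l2 y = l & p2 y = x }.

(* Every copy of a class of [v] in [B2] is replaced by a copy of [B1]. *)
Definition subst_edges : set (seq ((L2 * I) * vert B1) * C) := fun e =>
  (const_on fst e.1 /\ edges B1 (map_edge snd e)) \/
  [/\ ~ const_on fst e.1, forall y, y \in e.1 -> v (p1 y.2) = y.1.2 &
      edges B2 (map_edge (fun y => s2val (q2 y.1.1 (p1 y.2))) e)].

Lemma subst_edges_wf e : subst_edges e ->
  [/\ 2 <= size e.1, uniq e.1 & (colours B1 `|` colours B2) e.2].
Proof.
case=> [[_ Be]|[_ _ Be]]; have [] := edges_wf _ _ Be;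
  rewrite /= size_map => sz /map_uniq un; split=> //.
  by left; apply: (edges_colours Be).
by right; apply: (edges_colours Be).
Qed.

Definition subst : hypergraph C :=
  of_edges (finite_coloursU B1 B2) subst_edges_wf.

Lemma blowup_subst :
  @blowup G I v subst _ (fun y => p1 y.2) (fun y => (y.1, l1 y.2)).
Proof.
have [pI1 pS1 pT1] := pB1; have [pI2 pS2 pT2] := pB2; split.
- by move=> [a b] [c d] [-> e1 e2]; congr pair; apply: pI1; rewrite e1 e2.
- move=> e le ve.
  have c1 : const_on fst e.1 by apply: sub_const_on le => x y [].
  have E1 : edges B1 (map_edge snd e) <-> edges G (map_edge (p1 \o snd) e).
    rewrite pS1 ?map_edge_comp //; apply/const_on_map => //.
    by apply: sub_const_on le => x y [].
  by split=> [[[_ /E1]|[]]|/E1 ?] //; left.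
- move=> e [[c1 Be]|[nc ve Be] ve'].
    move=> ve x y xe ye; congr pair; first exact: c1.
    by apply: (pT1 _ Be); [exact/const_on_map| exact: map_f | exact: map_f].
  case: nc => x y xe ye; rewrite (surjective_pairing x.1) (surjective_pairing y.1).
  (* Inside one class of [v] the second indices agree, and the first ones do because [B2] is a
     blow-up; hence an edge across two copies of [B1] never stays in one class. *)
  have -> : x.1.2 = y.1.2 by rewrite -!ve //; apply: ve'.
  congr pair; have := pT2 _ Be; rewrite /= !const_on_map.
  have h : const_on ((v \o p2) \o (fun z : (L2 * I) * vert B1 => s2val (q2 z.1.1 (p1 z.2)))) e.1.
    by move=> a b ae be /=; rewrite !(s2valP' (q2 _ _)); apply: ve'.
  by move/(_ h) => /(_ x y xe ye) /=; rewrite !(s2valP (q2 _ _)).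
Qed.

Lemma embed_subst_copy (k : L2 * I) : @embed C B1 subst (fun y => (k, y)).
Proof.
split=> [x y [] //|e]; split=> [Be|].
  left; rewrite map_edge_comp /= map_edge_id; split=> //.
  by apply/const_on_map.
case=> [[_]|[] []]; first by rewrite map_edge_comp map_edge_id.
exact/const_on_map.
Qed.

(** Each copy of a class in [B2] is realised inside the copy of [B1] that replaced it. The condition
    on [l1] keeps it within a single copy there, so the edges inside it are those of [G]; all other
    edges were taken over from [B2]. *)
Lemma embed_subst_transversal (r : vert B2 -> vert B1) :
  (forall y, p1 (r y) = p2 y) ->
  (forall y z, l2 y = l2 z -> v (p2 y) = v (p2 z) -> l1 (r y) = l1 (r z)) ->
  @embed C B2 subst (fun y => ((l2 y, v (p2 y)), r y)).
Proof.
move=> pr lr; have [pI1 pS1 pT1] := pB1; have [pI2 pS2 pT2] := pB2; split.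
  by move=> x y [lxy _ rxy]; apply: pI2; rewrite lxy -!pr rxy.
set f := (fun y => _) => e.
have s2 : map_edge (fun y => s2val (q2 y.1.1 (p1 y.2))) (map_edge f e) = e.
  rewrite map_edge_comp -[RHS]map_edge_id; apply: eq_in_map_edge => y _ /=.
  by apply: pI2; rewrite (s2valP (q2 _ _)) (s2valP' (q2 _ _)) pr.
have [c|nc] := pselect (const_on fst (map f e.1)).
  have lc : const_on l2 e.1 by move/const_on_map: c; apply: sub_const_on => x y [].
  have vc : const_on (v \o p2) e.1 by move/const_on_map: c; apply: sub_const_on => x y [].
  have E1 : edges B2 e <-> edges B1 (map_edge snd (map_edge f e)).
    rewrite pS2 // pS1 ?map_edge_comp.
    - rewrite (_ : map_edge p2 e = map_edge (p1 \o (snd \o f)) e) //.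
      by apply: eq_in_map_edge => y _ /=; rewrite pr.
    - by apply/const_on_map=> x y xe ye /=; apply: lr; [apply: lc|apply: vc].
    - by apply/const_on_map=> x y xe ye /=; rewrite !pr; apply: vc.
  by rewrite E1; split=> [|[[]|[]]] //; left.
split=> [Be|[[]|[_ _]]] //; last by rewrite s2.
right; rewrite s2; split=> // _ /mapP[y ye ->] /=; by rewrite pr.
Qed.

End Subst.
End Substitution.
End Blowups.

(** * A partition theorem for blow-ups *)

Section Partition.
Variable C : Type.
Variables (G : hypergraph C) (I : finType) (v : vert G -> I) (K : finType).
Variable good : forall B : hypergraph C, (vert B -> vert G) -> (vert B -> K) -> Prop.
Arguments good : clear implicits.
Hypothesis good_embed : forall (B B' : hypergraph C) p c (f : vert B' -> vert B),
  embed f -> good B p c -> good B' (p \o f) (c \o f).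

Let full (B : hypergraph C) (L : finType) (p : vert B -> vert G) (l : vert B -> L) :=
  forall a x, exists2 y, l y = a & p y = x.

(** A list colouring condition: [T x] holds the colours allowed above [x]. Only complete blow-ups
    are considered, so that substitution finds a vertex above each [x] in every copy. *)
Let avail (T : vert G -> {set K}) := forall (B : hypergraph C) (L : finType) p l,
  @blowup C G I v B L p l -> full p l ->
  exists2 c, good B p c & forall y, c y \in T (p y).

Let upd (T : vert G -> {set K}) x S := fun z => if z == x then S else T z.

(* If [B1] has no good colouring avoiding [t] over [x], and [B2] none that is
   constantly [t] over [x], then in a good colouring of their substitution
   every copy of [B1] has colour [t] somewhere over [x], and these places give
   a transversal copy of [B2] that is constantly [t] over [x]. *)
Lemma avail_split (T : vert G -> {set K}) x t : t \in T x -> avail T ->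
  avail (upd T x (T x :\ t)%SET) \/ avail (upd T x [set t]%SET).
Proof.
move=> tT aT; apply: contrapT => /not_orP[].
move=> /existsNP[B1] /existsNP[L1] /existsNP[p1] /existsNP[l1].
move=> /not_implyP[b1] /not_implyP[f1] n1.
move=> /existsNP[B2] /existsNP[L2] /existsNP[p2] /existsNP[l2].
move=> /not_implyP[b2] /not_implyP[f2] n2.
pose q2 a z := cid2 (f2 a z).
have bS := blowup_subst b1 b2 q2.
have [|c gc cT] := aT _ _ _ _ bS.
  by move=> [a b] z; have [y ly py] := f1 b z; exists (a, y); rewrite //= ly.
have /choice[r1 r1P] : forall k : L2 * I, exists y, p1 y = x /\ c (k, y) = t.
  move=> k; apply: contrapT => nk; apply: n1.
  exists (fun y => c (k, y)).
    exact: good_embed (embed_subst_copy v p1 q2 k) gc.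
  move=> y; rewrite /upd; case: eqP => px; last exact: cT.
  rewrite in_setD1 -px; apply/andP; split; last exact: (cT (k, y)).
  by apply/eqP => ct; apply: nk; exists y.
(* Above [x] the vertex of colour [t] is taken. Every other vertex comes from the same copy within
   [B1] as that vertex, which gives the condition on [l1] for a transversal. *)
pose r y := if p2 y == x then r1 (l2 y, v x)
  else s2val (cid2 (f1 (l1 (r1 (l2 y, v (p2 y)))) (p2 y))).
have pr y : p1 (r y) = p2 y.
  rewrite /r; case: eqP => [->|_]; first by case: (r1P (l2 y, v x)).
  by case: cid2.
have lr y : l1 (r y) = l1 (r1 (l2 y, v (p2 y))).
  by rewrite /r; case: eqP => [->|_] //; case: cid2.
pose f y : vert (subst v p1 q2) := ((l2 y, v (p2 y)), r y).
have fE : embed f.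
  by apply: (embed_subst_transversal b1 b2) => // y z ly vy; rewrite !lr ly vy.
apply: n2; exists (c \o f).
  have := good_embed fE gc; rewrite (_ : _ \o f = p2) //.
  by apply/funext => y /=; rewrite pr.
move=> y; rewrite /upd; case: eqP => py.
  rewrite inE /= /f /r py eqxx; by case: (r1P (l2 y, v x)) => _ ->.
by rewrite -(pr y); apply: (cT (f y)).
Qed.

(** Splitting a list with two or more colours lowers the total size of the lists. In the end each
    has exactly one colour: none is empty, since the completion of [G] itself is coloured. *)
Lemma avail_singletons (T : vert G -> {set K}) : avail T ->
  exists chi, avail (fun x => [set chi x]%SET).
Proof.
have [k] := ubnP (\sum_x #|T x|); elim: k T => // k IH T; rewrite ltnS => Tk aT.
have [[x Tx]|nT] := pselect (exists x, 1 < #|T x|).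
  have /card_gt1P[t [t' [tT t'T tt']]] := Tx.
  have dec (S : {set K}) : #|S| < #|T x| -> \sum_z #|upd T x S z| < k.
    move=> ST; apply: leq_trans Tk.
    rewrite (bigD1 x) //= [X in _ < X](bigD1 x) //= /upd eqxx -addSn leq_add //.
    by apply: eq_leq; apply: eq_bigr => z /negPf ->.
  have [] := avail_split tT aT; apply: IH; apply: dec.
    by rewrite [X in _ < X](cardsD1 t) tT.
  by rewrite cards1.
have T1 x : exists t, T x = [set t]%SET.
  have := blowup_full (blowup_id v).
  move=> /aT[|c _ /(_ (tt, x)) cT]; first by move=> a z; exists (a, z).
  apply/cards1P; rewrite eqn_leq leqNgt; apply/andP; split.
    by apply/negP => h; apply: nT; exists x.
  by apply/card_gt0P; exists (c (tt, x)).
have [chi chiP] := choice T1; exists chi; rewrite (_ : (fun x => _) = T) //.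
by apply/funext => x; rewrite chiP.
Qed.

(** The lists are shrunk from all of [K] to one colour each, and a general blow-up inherits its
    colouring from its completion. In the applications the colours are either the factors or the
    labels of a decomposition. *)
Theorem blowup_partition :
  (forall (B : hypergraph C) (L : finType) p l, @blowup C G I v B L p l ->
     exists c, good B p c) ->
  exists chi : vert G -> K, forall (B : hypergraph C) (L : finType) p l,
    @blowup C G I v B L p l -> good B p (chi \o p).
Proof.
move=> gB; have [|chi chiP] := @avail_singletons (fun=> [set: K]%SET).
  by move=> B L p l b _; have [c gc] := gB _ _ _ _ b; exists c => // y; rewrite in_setT.
exists chi => B L p l b; have [|c gc cE] := chiP _ _ _ _ (blowup_full b).
  by move=> a z; exists (a, z).
have := good_embed (embed_full b) gc; rewrite (_ : snd \o _ = p) //.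
rewrite (_ : c \o _ = chi \o p) //; apply/funext => y /=.
by have := cE (l y, p y); rewrite inE => /eqP.
Qed.

End Partition.

(** * Decompositions as stable labellings *)

Section Stable.
Variable C : Type.
Implicit Types (G H B : hypergraph C) (P Q : hclass C).

(* For surjective [v] and [D] everywhere true, the classes of [v] form a
   [P]-decomposition of [G]. *)
Definition stable P G (I : eqType) (v : vert G -> I) (D : vert G -> Prop) : Prop :=
  forall B (L : finType) (p : vert B -> vert G) (l : vert B -> L),
    blowup v p l -> (forall y, D (p y)) -> P B.

(* For hereditary [P] this says that G[D] is in [P]. *)
Definition hered P G (D : vert G -> Prop) : Prop :=
  forall B (f : vert B -> vert G), embed f -> (forall y, D (f y)) -> P B.

Lemma stable_embed P G H (I : eqType) (v : vert H -> I) D D' (g : vert G -> vert H) :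
  embed g -> (forall x, D' x -> D (g x)) -> stable P v D -> stable P (v \o g) D'.
Proof.
move=> gE D'D sP B L p l b pD; apply: sP (embed_blowup gE b) _ => y.
exact/D'D/pD.
Qed.

Lemma stable_kernel P G (I J : eqType) (v : vert G -> I) (w : vert G -> J) D :
  (forall x y, D x -> D y -> (v x = v y <-> w x = w y)) ->
  stable P v D -> stable P w D.
Proof.
move=> vw sP B L p l [pI pS pT] pD; apply: (sP B L p l) => //.
have vwP s : const_on (v \o p) s <-> const_on (w \o p) s.
  by split=> c x y xs ys; apply/vw => //; apply: c.
by split=> // e; rewrite vwP; [exact: pS | exact: pT].
Qed.

(** * Decompositions correspond to stable labellings *)

Lemma copies_edgesP k G e : edges (copies k G) e <->
  const_on tag e.1 /\ edges G (map_edge (fun y : {_ : 'I_k & vert G} => tagged y) e).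
Proof.
split=> [[i _ [e' Ge' <-]]|[c Ge]].
  split; first exact/const_on_map.
  by rewrite map_edge_comp (_ : map_edge _ e' = e') // -[RHS]map_edge_id;
     apply: eq_in_map_edge.
have [sz _] := edges_wf _ _ Ge; rewrite size_map in sz.
case E : e.1 sz => [//|y s] _.
exists (tag y) => //; exists (map_edge (fun y : {_ : 'I_k & vert G} => tagged y) e) => //.
rewrite map_edge_comp -[RHS]map_edge_id; apply: eq_in_map_edge => -[j z] ze /=.
by rewrite (c y (existT _ j z)) ?E ?mem_head // -E.
Qed.

Lemma lift_edge (V : finType) (U : {set V}) (e : seq V * C) :
  (forall x, x \in e.1 -> x \in U) ->
  exists e', e = map_edge (val : {x | x \in U} -> V) e'.
Proof.
case: e => s c /= sU; exists (pmap insub s, c); congr pair.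
elim: s sU => //= x s IH sU; rewrite (insubT (fun x => x \in U) (sU x (mem_head _ _))) /=.
by congr cons; apply: IH => y ys; apply: sU; rewrite inE ys orbT.
Qed.

Lemma decomposition_stable P G n (A : 'I_n -> {set vert G}) :
  induced_hereditary P -> is_decomposition P A ->
  exists v : vert G -> 'I_n, [/\ forall i x, x \in A i <-> v x = i,
    forall i, exists x, v x = i & stable P v (fun=> True)].
Proof.
move=> Ph [[Ac Ad] An AP]; have [v vP] := choice Ac; exists v.
have vA i x : x \in A i <-> v x = i by split=> [/(Ad _ _ _ (vP x)) //|<-].
split=> // [i|B L p l [pI pS pT] _].
  by have /finset.set0Pn[x xA] := An i; exists x; apply/vA.
(* One copy more than [L] has elements, because [L] may be empty while a decomposition speaks only
   of positive [k]. *)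
pose r (a : L) : 'I_#|L|.+1 := widen_ord (leqnSn _) (enum_rank a).
have rI : injective r by move=> a b /(congr1 val) /= /val_inj /enum_rank_inj.
have b : blowup v p (r \o l).
  have rc s : const_on (r \o l) s <-> const_on l s.
    by split=> c x y xs ys; [apply: rI|congr r]; apply: c.
  split=> [x y rlp|e|e]; rewrite ?rc.
  - apply: pI; rewrite (rI _ _ (congr1 fst rlp)); congr pair.
    by have := congr1 snd rlp.
  - exact: pS.
  - exact: pT.
apply: induced_hereditary_embed Ph (embed_full b) _.
apply: (AP #|L|.+1) => //; have [fI fS fT] := blowup_full b.
exists (fun i => [set y | v y.2 == i]%SET); split.
  split=> [y|i j y]; first by exists (v y.2); rewrite inE.
  by rewrite !inE => /eqP <- /eqP.
move=> i; apply: iso_sym.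
pose g (y : vert (copies #|L|.+1 (induced (A i)))) : vert (full b) :=
  (tag y, val (tagged y)).
have gv y : v (g y).2 = i by apply/vA; exact: valP (tagged y).
apply: (@embed_induced_iso _ _ _ g).
  split=> [[a x] [c y] [/= ac]|e].
    by move/val_inj => xy; rewrite ac xy.
  have vc : const_on (v \o snd) (map_edge g e).1.
    by apply/const_on_map => x y _ _ /=; rewrite !gv.
  rewrite copies_edgesP; split=> [[c Ge]|Fe].
    have fc : const_on fst (map_edge g e).1 by apply/const_on_map.
    by apply/(fS _ fc vc); move: Ge; rewrite /= /induced_edges /= !map_edge_comp.
  have fc := fT _ Fe vc; split; first by move/const_on_map: fc.
  by move/(fS _ fc vc): Fe; rewrite /= /induced_edges /= !map_edge_comp.
move=> y; rewrite inE; split=> [/eqP/vA yA|[x <-]]; last by rewrite gv.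
by exists (existT _ y.1 (exist _ y.2 yA)); rewrite /g /= -surjective_pairing.
Qed.

Lemma stable_decomposition P G n (v : vert G -> 'I_n) :
  (forall i, exists x, v x = i) -> stable P v (fun=> True) ->
  is_decomposition P (fun i => [set x | v x == i]%SET).
Proof.
move=> vs sP; split.
- split=> [x|i j x]; first by exists (v x); rewrite inE.
  by rewrite !inE => /eqP <- /eqP.
- by move=> i; have [x xi] := vs i; apply/finset.set0Pn; exists x; rewrite inE xi.
move=> k _ H [A [[Ac Ad] AP]].
pose phi i := s2val (cid2 (iso_embed (AP i))).
have phiE i : embed (phi i) := s2valP (cid2 (iso_embed (AP i))).
pose g i y := (tag (phi i y), val (tagged (phi i y))) : 'I_k * vert G.
have gv i y : v (g i y).2 = i.
  by have := valP (tagged (phi i y)); rewrite inE => /eqP.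
(* The isomorphisms on the parts are glued to one map [q], giving copy number and vertex of [G]; it
   exhibits [H] as a blow-up. *)
have /choice[q qP] : forall z, exists q : 'I_k * vert G,
    forall i (h : z \in A i), q = g i (exist _ z h).
  move=> z; have [i zi] := Ac z; exists (g i (exist _ z zi)) => j zj.
  by have ij := Ad _ _ _ zi zj; subst j; rewrite (bool_irrelevance zi zj).
have qA z : z \in A (v (q z).2).
  by have [i zi] := Ac z; rewrite (qP z i zi) gv.
have qE e : const_on (fun z => v (q z).2) e.1 ->
    edges H e <-> const_on (fun z => (q z).1) e.1 /\
      edges G (map_edge (fun z => (q z).2) e).
  move=> vc; have [sz|] := boolP (1 < size e.1); last first.
    move=> /negP ns; split=> [/edges_wf[]|[_ /edges_wf[]]] //.
    by rewrite size_map.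
  case E : e.1 sz => [//|z s] _.
  have [|e' ee] := @lift_edge _ (A (v (q z).2)) e.
    by move=> x xe; rewrite (vc z x) ?E ?mem_head -?E.
  set i := v (q z).2 in e' ee.
  have qg y : q (val y) = g i y by case: y => y yA; apply: qP.
  have -> : edges H e <-> edges (copies k (induced [set x | v x == i]%SET)) (map_edge (phi i) e').
    by rewrite -(phiE i).2 {1}ee.
  rewrite copies_edgesP -E ee /= /induced_edges /= !map_edge_comp.
  rewrite !const_on_map.
  rewrite (_ : map_edge ((fun z => (q z).2) \o _) e' =
      map_edge (snd \o g i) e'); last by apply: eq_in_map_edge => y _ /=; rewrite qg.
  rewrite (_ : (fun z => (q z).1) \o val = fst \o g i) //.
  by apply/funext => y /=; rewrite qg.
apply: (sP H _ (fun z => (q z).2) (fun z => (q z).1)) => //.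
split=> [x y|e lc vc|e He vc].
- rewrite -!surjective_pairing => qxy.
  have := qA x; have := qA y; rewrite -qxy; set i := v _ => yi xi.
  move: qxy; rewrite (qP x i xi) (qP y i yi) => -[t1 /val_inj t2].
  suff : phi i (exist _ x xi) = phi i (exist _ y yi) by move/(phiE i).1 => [].
  by case: (phi i _) t1 t2 => a c; case: (phi i _) => a' c' /= -> ->.
- by rewrite qE //; split=> [[]|].
- by case/qE: He.
Qed.

Lemma stable_image_decomposition P G (J : finType) (v : vert G -> J) :
  stable P v (fun=> True) ->
  exists A : 'I_#|[set v x | x in predT]%SET| -> {set vert G}, is_decomposition P A.
Proof.
move=> sP; set S := [set v x | x in predT]%SET.
have vS x : v x \in S by apply/imsetP; exists x.
(* [enum_rank_in] needs an element of [S]; without vertices the decomposition has 0 parts. *)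
have [/existsP[x0 _]|/existsPn nx] := boolP [exists x : vert G, true]; last first.
  have S0 : #|S| = 0.
    apply/eqP; rewrite cards_eq0; apply/eqP/finset.setP => j; rewrite inE.
    by apply/negP => /imsetP[x _ _]; have := nx x.
  have w (x : vert G) : 'I_#|S| by have := nx x.
  exists (fun i => [set x | w x == i]%SET); apply: stable_decomposition.
    by case=> i h; exfalso; rewrite S0 in h.
  by apply: stable_kernel sP => x; have := nx x.
pose w x := enum_rank_in (vS x0) (v x).
have wK x : enum_val (w x) = v x by rewrite enum_rankK_in.
exists (fun i => [set x | w x == i]%SET); apply: stable_decomposition.
  move=> i; have /imsetP[x _ xi] := enum_valP i.
  by exists x; apply: enum_val_inj; rewrite wK xi.
apply: stable_kernel sP => x y _ _; split=> [vxy|wxy]; last by rewrite -!wK wxy.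
by apply: enum_val_inj; rewrite !wK.
Qed.

Lemma leq_dec_at P G (J : finType) (v : vert G -> J) :
  P G -> stable P v (fun=> True) -> #|[set v x | x in predT]%SET| <= dec_at P G.
Proof.
move=> PG sP; rewrite /dec_at asboolT //; set k := #|_|.
have kG : k < #|vert G|.+1 by rewrite ltnS leq_imset_card.
rewrite (bigmax_sup (Ordinal kG)) //; apply/asboolP.
exact: stable_image_decomposition.
Qed.

(** No edge joins two classes of [l], so [B] embeds in the disjoint union of its classes. *)
Lemma additive_classes Q B (L : finType) (l : vert B -> L) :
  additive Q -> induced_hereditary Q ->
  (forall e, edges B e -> const_on l e.1) ->
  (forall a, Q (induced [set y | l y == a]%SET)) -> Q B.
Proof.
move=> Qa Qh lc Ql; pose U a := [set y | l y == a]%SET.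
have lU y : y \in U (l y) by rewrite inE.
pose f y : vert (dunion (fun a => induced (U a))) :=
  existT (fun a => vert (induced (U a))) (l y)
    (exist (fun z => z \in U (l y)) y (lU y)).
pose h (y : vert (dunion (fun a => induced (U a)))) : vert B := val (tagged y).
have hf y : h (f y) = y by [].
have fh y : f (h y) = y.
  case: y => a [y ya]; have la : l y = a by apply/eqP; move: ya; rewrite inE.
  by subst a; rewrite /f /h /=; congr existT; apply: val_inj.
apply: (@induced_hereditary_embed _ Q _ _ f Qh _ (Qa _ _ Ql)).
split=> [x y /(congr1 h)|e]; first by rewrite !hf.
split=> [Be|[a _ [e' He' ee']]].
  have [] := edges_wf _ _ Be; case E : e.1 => [//|y s] _ _.
  have [|e' ee'] := @lift_edge _ (U (l y)) e.
    by move=> x xe; rewrite inE; apply/eqP; apply: (lc e Be) => //; rewrite E mem_head.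
  exists (l y) => //; exists e'; first by rewrite /= /induced_edges /= -ee'.
  rewrite ee' map_edge_comp; apply: eq_in_map_edge => z _ /=.
  exact: esym (fh (Tagged (fun a => vert (induced (U a))) z)).
rewrite (_ : e = map_edge h (map_edge f e)).
  by rewrite -ee' map_edge_comp; exact: He'.
by rewrite map_edge_comp -[LHS]map_edge_id; apply: eq_in_map_edge => y _.
Qed.

(** A blow-up of a single class is a disjoint union of induced subhypergraphs of that class, so
    additivity suffices. *)
Lemma hered_stable Q G (I : eqType) (v : vert G -> I) D :
  additive Q -> induced_hereditary Q ->
  (forall x y, D x -> D y -> v x = v y) -> hered Q D -> stable Q v D.
Proof.
move=> Qa Qh Dv Qc B L p l [pI pS pT] pD.
have vc s : const_on (v \o p) s by move=> x y _ _; apply: Dv.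
apply: (@additive_classes Q B L l) => // [e Be|a]; first exact: pT.
have la (y : vert (induced [set y | l y == a]%SET)) : l (val y) = a.
  by apply/eqP; have := valP y; rewrite inE.
apply: (Qc _ (fun y : vert (induced [set y | l y == a]%SET) => p (val y)));
  last by move=> y; exact: pD.
split=> [x y /= pxy|e]; first by apply/val_inj/pI; rewrite !la pxy.
rewrite /= /induced_edges /= pS ?map_edge_comp //.
by apply/const_on_map => x y _ _ /=; rewrite !la.
Qed.

Lemma dec_at_stable P G : additive P -> induced_hereditary P -> P G ->
  exists v : vert G -> 'I_(dec_at P G),
    (forall i, exists x, v x = i) /\ stable P v (fun=> True).
Proof.
move=> Pa Ph PG.
have [A AP] : exists A : 'I_(dec_at P G) -> {set vert G}, is_decomposition P A.
  rewrite /dec_at asboolT //.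
  (* The trivial labelling shows that some number of parts is admissible, so the maximum is attained
     and is not a default value. *)
  have s1 : stable P (fun _ : vert G => tt) (fun=> True).
    apply: hered_stable => // B f fE _.
    exact: induced_hereditary_embed fE PG.
  have [A1 A1P] := stable_image_decomposition s1; set k := #|_| in A1 A1P.
  have kG : k < #|vert G|.+1 by rewrite ltnS leq_imset_card.
  pose F : pred 'I_#|vert G|.+1 := fun n =>
    `[< exists A : 'I_n -> {set vert G}, is_decomposition P A >].
  have F1 : F (Ordinal kG) by apply/asboolP; exists A1.
  rewrite (eq_bigl (mem F)) //.
  have [j jF ->] := eq_bigmax_cond (fun n : 'I_#|vert G|.+1 => (n : nat))
    (introT card_gt0P (ex_intro (fun x => x \in F) _ F1)).
  exact/asboolP.
by have [v [_ vs vP]] := decomposition_stable Ph AP; exists v.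
Qed.

(** If [G0] missed the class of [x], then in any member of [G0 * K1] the added vertex could be sent
    to [x]. It would be alone in its class, so its edges to [G0] would be unrestricted and the
    member would be a blow-up of [w], hence in [P], against strictness. *)
Lemma strict_surj P G0 G (J : eqType) (w : vert G -> J) D (g : vert G0 -> vert G) :
  strict P G0 -> embed g -> (forall y, D (g y)) -> stable P w D ->
  forall x, D x -> exists y, w (g y) = w x.
Proof.
move=> [_ nP] [gI gE] gD sP x Dx; apply: contrapT => nx; apply: nP.
move=> Z [A [[Ac Ad] AP]].
have [f [fI fE] _] : exists2 f : vert (induced (A true)) -> vert G0,
    embed f & bijective f := iso_embed (AP true).
have [h [hI hE] _] : exists2 h : vert (induced (A false)) -> unit,
    @embed C _ (K1 C) h & bijective h := iso_embed (AP false).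
have /choice[p pP] : forall z, exists y,
    (forall zt : z \in A true, y = g (f (exist _ z zt))) /\ (z \in A false -> y = x).
  move=> z; have [[] zA] := Ac z.
    exists (g (f (exist _ z zA))); split=> [zt|/(Ad _ _ _ zA) //].
    by congr (g (f _)); apply: val_inj.
  by exists x; split=> // zt; have := Ad _ _ _ zA zt.
have pA (z : vert (induced (A true))) : p (val z) = g (f z).
  by case: z => z zA; apply: (pP z).1.
have A1 z z' : z \in A false -> z' \in A false -> z = z'.
  move=> zA zA'.
  have : h (exist _ z zA) = h (exist _ z' zA') by case: (h _); case: (h _).
  by move/hI => [].
have pT z : w (p z) <> w x -> z \in A true.
  by have [[] zA] := Ac z; rewrite // (pP z).2.
have pF z : w (p z) = w x -> z \in A false.
  have [[] zA] := Ac z => //; rewrite (pP z).1 => wz.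
  by case: nx; exists (f (exist _ z zA)).
apply: (sP Z unit p (fun=> tt)) => [|z]; last first.
  by have [[] zA] := Ac z; [rewrite (pP z).1|rewrite (pP z).2].
split=> [z z' [pz]|e _ wc|e _ _ y z _ _] //.
  have [/pF zF|/pT zT] := pselect (w (p z) = w x).
    by apply: A1 => //; apply: pF; rewrite -pz (pP z).2.
  have zT' : z' \in A true.
    have [[] z'A] := Ac z' => //; case: nx.
    by exists (f (exist _ z zT)); rewrite -(pP z).1 pz (pP z').2.
  by move: pz; rewrite (pP z).1 (pP z').1 => /gI/fI[].
have [sz|/negP ns] := boolP (1 < size e.1); last first.
  by split=> /edges_wf[] //; rewrite size_map.
case E : e.1 sz => [//|z s] _.
(* The class of [x] contains only the added vertex, and an edge needs two; in every other class the
   edges are those of [G0]. *)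
have [wz|wz] := pselect (w (p z) = w x).
  have eF y : y \in e.1 -> y \in A false.
    by move=> ye; apply: pF; rewrite -wz; apply: wc => //; rewrite E mem_head.
  have tw : ~ (1 < size e.1 /\ uniq e.1).
    case: (e.1) eF => [|a [|b t]] eF []//= _.
    by rewrite (A1 a b) ?mem_head //; apply: eF; rewrite !inE eqxx ?orbT.
  split=> /edges_wf //=; rewrite size_map => -[sz /map_uniq un]; by case: tw.
have [|e' ee'] := @lift_edge _ (A true) e.
  move=> y ye; apply: pT => wy; apply: wz; rewrite -wy; apply: wc => //.
  by rewrite E mem_head.
have -> : edges Z e <-> edges G0 (map_edge f e') by rewrite -fE {1}ee'.
rewrite gE ee' !map_edge_comp (_ : map_edge (p \o _) e' = map_edge (g \o f) e') //.
by apply: eq_in_map_edge => y _ /=; apply: pA.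
Qed.

Lemma strict_leq P G0 G (J : finType) (w : vert G -> J) D (g : vert G0 -> vert G) :
  strict P G0 -> embed g -> (forall y, D (g y)) -> stable P w D ->
  #|[set w (g y) | y in predT]%SET| <= dec_at P G0.
Proof.
move=> [PG0 _] gE gD sP; apply: (@leq_dec_at P G0 J (w \o g)) => //.
exact: stable_embed sP.
Qed.

(* Deleting the edges that are not monochromatic for [xi] turns a blow-up of
   [(a, xi)] into a blow-up of [a]; the stability of [w] restores the deleted
   edges. *)
Lemma stable_refine P G (I K : finType) (a : vert G -> I) (xi : vert G -> K) :
  (forall B (L : finType) (p : vert B -> vert G) (l : vert B -> L),
     blowup a p l -> exists H (f : vert B -> vert H) (w : vert H -> K),
       [/\ embed f, stable P w (fun=> True) & forall y, xi (p y) = w (f y)]) ->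
  stable P (fun x => (a x, xi x)) (fun=> True).
Proof.
move=> hP Y L p l [pI pS pT] _.
pose E : set (seq (vert Y) * C) := fun e => edges Y e /\ const_on (xi \o p) e.1.
have Ewf e : E e -> [/\ 2 <= size e.1, uniq e.1 & colours Y e.2].
  by case=> Ye _; have [sz un] := edges_wf _ _ Ye; split=> //; apply: edges_colours.
pose B := of_edges (finite_colours Y) Ewf.
have axc s : const_on (a \o p) s -> const_on (xi \o p) s ->
    const_on ((fun x => (a x, xi x)) \o p) s.
  by move=> ac xc x y xs ys /=; congr pair; [apply: ac|apply: xc].
have bB : @blowup C G I a B (L * K)%type p (fun y => (l y, xi (p y))).
  split=> [x y [lxy _ pxy]|e lc ac|e [Ye xc] ac x y xs ys].
  - by apply: pI; rewrite lxy pxy.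
  - have xc : const_on (xi \o p) e.1 by apply: sub_const_on lc => x y [].
    have {}lc : const_on l e.1 by apply: sub_const_on lc => x y [].
    by rewrite -pS; [split=> [[]|]|exact: lc|exact: axc].
  - by congr pair; [apply: (pT e) => //; apply: axc|apply: xc].
have [H [f [w [[fI fE] sP xw]]]] := hP _ _ _ _ bB.
apply: (sP Y unit f (fun=> tt)) => //; split=> [x y [/fI]|e _ wc|e _ _ x y _ _] //.
rewrite -fE; split=> [Ye|[]] //; split=> //.
by move=> x y xs ys /=; rewrite !xw; apply: wc.
Qed.

End Stable.

(** * Disjoint unions *)

Section DisjointUnions.
Variable C : Type.
Implicit Types (G H B X : hypergraph C) (P Q : hclass C).

Lemma embed_factor X G H (a : vert X -> vert G) (i : vert G -> vert H)
    (f : vert X -> vert H) :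
  embed i -> embed f -> (forall x, f x = i (a x)) -> embed a.
Proof.
move=> [iI iE] [fI fE] fa; split=> [x y axy|e]; first by apply: fI; rewrite !fa axy.
rewrite fE iE map_edge_comp (_ : map_edge f e = map_edge (i \o a) e) //.
by apply: eq_in_map_edge => x _ /=.
Qed.

Lemma hered_image Q G H (i : vert G -> vert H) (D : vert H -> Prop) :
  embed i -> (forall x, D x -> exists y, i y = x) ->
  hered Q (D \o i) -> hered Q D.
Proof.
move=> iE Di hQ X f fE fD; have /choice[a aP] : forall x, exists y, i y = f x.
  by move=> x; apply/Di/fD.
apply: (hQ X a); first by apply: (embed_factor iE fE) => x; rewrite aP.
by move=> x /=; rewrite aP.
Qed.

Lemma hered_sub Q G (D D' : vert G -> Prop) :
  (forall x, D' x -> D x) -> hered Q D -> hered Q D'.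
Proof. by move=> DD hQ X f fE fD; apply: (hQ X f) => // y; apply/DD/fD. Qed.

Lemma hered_embed Q G H (i : vert G -> vert H) (D : vert H -> Prop) :
  embed i -> hered Q D -> hered Q (D \o i).
Proof. by move=> iE hQ X f fE fD; apply: (hQ X (i \o f)) => //; apply: embed_comp. Qed.

Section Dunion.
Variables (I : finType) (F : I -> hypergraph C).

Lemma lift_tag i (s : seq (vert (dunion F))) :
  (forall y, y \in s -> tag y = i) ->
  exists s' : seq (vert (F i)), s = map (Tagged (fun i => vert (F i))) s'.
Proof.
elim: s => [|[j y] s IH] h; first by exists [::].
have [|s' ->] := IH; first by move=> z zs; apply: h; rewrite inE zs orbT.
by have /= ji := h _ (mem_head _ _); subst j; exists (y :: s').
Qed.

Lemma embed_Tagged i :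
  @embed C (F i) (dunion F) (Tagged (fun i => vert (F i))).
Proof.
have TI j : injective (Tagged (fun i => vert (F i)) (i := j)).
  by move=> x y /eqP; rewrite eq_Tagged => /eqP.
split=> // e; split=> [Fe|[j _ [e' Fe']]]; first by exists i => //; exists e.
have [+ _] := edges_wf _ _ Fe'; case: e' Fe' => [[//|y s] c] Fe' _ ee.
have ji : j = i.
  by have := congr1 (fun e => map tag e.1) ee; rewrite /=; case: (e.1) => //= z t [].
by subst j; rewrite -(map_edge_inj (@TI i) ee).
Qed.

Lemma dunion_const e : edges (dunion F) e -> const_on tag e.1.
Proof. by move=> [j _ [e' Fe' <-]]; apply/const_on_map. Qed.

Lemma hered_dunion Q (D : vert (dunion F) -> Prop) :
  additive Q -> induced_hereditary Q ->
  (forall i, hered Q (fun x : vert (F i) => D (Tagged (fun i => vert (F i)) x))) ->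
  hered Q D.
Proof.
move=> Qa Qh hQ X f fE fD; apply: (@additive_classes C Q X I (tag \o f)) => //.
  by move=> e /fE.2/dunion_const/const_on_map.
move=> i; pose U := [set y | (tag \o f) y == i]%SET.
have hi : hered Q (fun x : vert (dunion F) => tag x = i /\ D x).
  apply: (hered_image (embed_Tagged i)).
    by case=> [j x] /= [ji _]; subst j; exists x.
  by apply: hered_sub (hQ i) => x [].
apply: (hi _ (fun x : vert (induced U) => f (val x))).
  exact: embed_comp (embed_induced U) fE.
by move=> x; split; [have := valP x; rewrite inE => /eqP|apply: fD].
Qed.

(** Copy numbers are tagged by the component, so different components share no copy. Thus one
    blow-up can contain several prescribed ones. *)
Lemma blowup_dunion G (J : eqType) (v : vert G -> J) (L : I -> finType)
    (p : forall i, vert (F i) -> vert G) (l : forall i, vert (F i) -> L i) :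
  (forall i, blowup v (p i) (l i)) ->
  @blowup C G J v (dunion F) {i : I & L i} (fun y => p (tag y) (tagged y))
    (fun y => Tagged L (l (tag y) (tagged y))).
Proof.
move=> b; split.
- move=> [i x] [j y] [ij]; subst j => /= lxy pxy.
  have [pI _ _] := b i; congr existT; apply: pI; rewrite pxy; congr pair.
  by have /eqP := lxy; rewrite eq_Tagged /= => /eqP.
- move=> e lc vc.
  have [sz|/negP ns] := boolP (1 < size e.1); last first.
    by split=> /edges_wf[] //; rewrite size_map.
  case: e sz lc vc => [[//|y t] c] _ lc vc.
  have [|s' ss] := @lift_tag (tag y) (y :: t).
    move=> z zs; by have := congr1 tag (lc z y zs (mem_head _ _)).
  move: lc vc; rewrite ss => lc vc; have [_ pS _] := b (tag y).
  pose e' := (s', c); rewrite -[(_, c)]/(map_edge (Tagged (fun i => vert (F i))) e').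
  rewrite -(embed_Tagged _).2 map_edge_comp pS //; last by move/const_on_map: vc.
  move/const_on_map: lc => lc z z' zs zs'; have /eqP := lc z z' zs zs'.
  by rewrite /= eq_Tagged /= => /eqP.
- move=> e [i _ [e' Fe' <-]] /= /const_on_map vc; apply/const_on_map.
  have [_ _ pT] := b i; move=> z z' zs zs' /=; congr existT.
  by apply: (pT e').
Qed.

End Dunion.

Lemma iso_K1 H (x : vert H) : iso (induced [set x]%SET) (K1 C).
Proof.
apply: iso_sym; apply: (@embed_induced_iso _ (K1 C) H (fun=> x)).
  split=> [[] [] //|e]; split=> // /edges_wf[]; rewrite /= size_map.
  by case: (e.1) => [|a [|b s]] //= _; rewrite inE eqxx.
by move=> y; rewrite inE; split=> [/eqP ->|[_ ->]] //; exists tt.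
Qed.

(** A member [Z] of [G0 * K1] is glued to [G] along [G0]. The result [Z'] is in [G * K1] and
    contains [Z], so [Z] would be in [P] if [G * K1] were. *)
Lemma strict_embed P G0 G (g : vert G0 -> vert G) :
  induced_hereditary P -> strict P G0 -> embed g -> P G -> strict P G.
Proof.
move=> Ph [_ nP] [gI gE] PG; split=> // sP; apply: nP => Z [A [[Ac Ad] AP]].
have [f [fI fE] _] : exists2 f : vert (induced (A true)) -> vert G0,
    embed f & bijective f := iso_embed (AP true).
have [h [hI hE] _] : exists2 h : vert (induced (A false)) -> unit,
    @embed C _ (K1 C) h & bijective h := iso_embed (AP false).
have /choice[q qP] : forall z, exists y,
    (forall zt : z \in A true, y = Some (g (f (exist _ z zt)))) /\
    (z \in A false -> y = None).
  move=> z; have [[] zA] := Ac z.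
    exists (Some (g (f (exist _ z zA)))); split=> [zt|/(Ad _ _ _ zA) //].
    by congr (Some (g (f _))); apply: val_inj.
  by exists None; split=> // zt; have := Ad _ _ _ zA zt.
have qS (z : vert (induced (A true))) : q (val z) = Some (g (f z)).
  by case: z => z zA; apply: (qP z).1.
have qT z : q z -> z \in A true by have [[] zA] := Ac z; rewrite // (qP z).2.
have qI : injective q.
  move=> z z'; have [[] zA] := Ac z; have [[] zA'] := Ac z'.
  - by rewrite (qP z).1 (qP z').1 => -[] /gI/fI[].
  - by rewrite (qP z).1 (qP z').2.
  - by rewrite (qP z).2 ?(qP z').1.
  - have : h (exist _ z zA) = h (exist _ z' zA') by case: (h _); case: (h _).
    by move/hI => [].
pose E : set (seq (option (vert G)) * C) := fun e =>
  (exists2 e', edges Z e' & e = map_edge q e') \/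
  (exists2 e', edges G e' & e = map_edge Some e').
have Ewf e : E e -> [/\ 2 <= size e.1, uniq e.1 & (colours Z `|` colours G) e.2].
  case=> -[e' He' ->]; have [sz un] := edges_wf _ _ He'; rewrite /= size_map.
    by split; rewrite ?map_inj_uniq //; left; apply: edges_colours.
  by split; rewrite ?map_inj_uniq //; first [move=> x y [] | right; apply: edges_colours].
pose Z' := of_edges (finite_coloursU Z G) Ewf.
(* [Z] and [G] agree on their common part [G0], so gluing adds no edge inside either. *)
have ZG e e' : map_edge q e = map_edge Some e' -> edges Z e <-> edges G e'.
  move=> ee; have [|e3 e3E] := @lift_edge _ _ (A true) e.
    move=> x xe; apply: qT; have /(map_f q) : x \in e.1 by [].
    by have /= -> := congr1 fst ee => /mapP[y _ ->].
  have -> : edges Z e <-> edges G0 (map_edge f e3) by rewrite -fE {1}e3E.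
  rewrite gE map_edge_comp (_ : map_edge _ e3 = e') //.
  apply: (@map_edge_inj _ _ _ Some) => [x y []//|].
  rewrite -ee e3E !map_edge_comp; apply: eq_in_map_edge => x _ /=.
  by rewrite qS.
apply: (@induced_hereditary_embed _ P Z Z' q) => //.
  split=> // e; split=> [Ze|]; first by left; exists e.
  by case=> [[e' Ze' /(map_edge_inj qI) ->]|[e' Ge' /ZG ->]].
apply: sP; exists (fun b => [set y | isSome y == b]%SET); split.
  split=> [y|i j y]; first by exists (isSome y); rewrite inE.
  by rewrite !inE => /eqP <- /eqP.
case.
  apply: iso_sym; apply: (@embed_induced_iso _ G Z' Some).
    split=> [x y [] //|e]; split=> [Ge|]; first by right; exists e.
    case=> [[e' Ze' /esym/ZG <- //]|[e' Ge']].
    by move/(@map_edge_inj _ _ _ Some (fun x y => @Some_inj _ x y)) ->.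
  by case=> [y|]; rewrite inE; split=> // k; [exists y | case: k].
rewrite (_ : [set y | _]%SET = [set (None : vert Z')]%SET); first exact: iso_K1.
by apply/finset.setP => -[y|]; rewrite !inE.
Qed.

End DisjointUnions.

(** * Factorisations *)

Section Factorisation.
Variables (C : Type) (P : hclass C) (m : nat) (Q : 'I_m -> hclass C).
Hypotheses (Pprop : is_property P) (Padd : additive P)
  (Pher : induced_hereditary P)
  (Qadd : forall i, additive (Q i)) (Qher : forall i, induced_hereditary (Q i))
  (Qind : forall i, indecomposable (Q i)) (PQ : forall H, P H <-> circ Q H).
Implicit Types G H B : hypergraph C.

Let all G : vert G -> Prop := fun=> True.
Arguments all {G}.

Lemma factor_colouring H : P H <->
  exists chi : vert H -> 'I_m, forall i, hered (Q i) (fun x => chi x = i).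
Proof.
rewrite PQ; split=> [[A [[Ac Ad] AQ]]|[chi chiQ]].
  have [chi chiA] := choice Ac; exists chi => i X f fE fi.
  have fA x : f x \in A i by rewrite -(fi x).
  pose a x : vert (induced (A i)) := exist _ (f x) (fA x).
  apply: (induced_hereditary_embed (@Qher i) _ (AQ i)).
  exact: (@embed_factor _ _ _ _ a _ f (embed_induced (A i)) fE).
exists (fun i => [set x | chi x == i]%SET); split.
  split=> [x|i j x]; first by exists (chi x); rewrite inE.
  by rewrite !inE => /eqP <- /eqP.
move=> i; apply: chiQ (embed_induced _) _ => x.
by have := valP x; rewrite inE => /eqP.
Qed.

(** In a blow-up of the refined labelling, the vertices above colour [i] form a blow-up of [v]
    alone, which lies in [Q i]. *)
Lemma stable_factors G (I : finType) (v : vert G -> I) (chi : vert G -> 'I_m) :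
  (forall i, stable (Q i) v (fun x => chi x = i)) ->
  stable P (fun x => (chi x, v x)) all.
Proof.
move=> sQ B L p l b _; apply/factor_colouring; exists (chi \o p) => i X f fE fi.
have [pI pS pT] := blowup_embed b fE.
have vc s : const_on (v \o (p \o f)) s -> const_on ((fun x => (chi x, v x)) \o (p \o f)) s.
  by move=> c x y xs ys /=; have /= -> := c x y xs ys; rewrite -!/((chi \o p) _) !fi.
apply: (sQ i X L (p \o f) (l \o f)) => //; split=> // e.
  by move=> lc /vc; apply: pS.
by move=> Xe /vc; apply: pT.
Qed.

Lemma stable_colouring G (chi : vert G -> 'I_m) :
  (forall i, hered (Q i) (fun x => chi x = i)) -> stable P chi all.
Proof.
move=> hQ; have sQ i : stable (Q i) chi (fun x => chi x = i).
  by apply: hered_stable (hQ i) => // x y -> ->.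
by apply: stable_kernel (stable_factors sQ) => x y _ _; split=> [[]|->].
Qed.

(** Every blow-up of [v] is in [P] and so has a factor colouring; the partition theorem makes these
    depend only on the vertex of [G]. Nothing is said yet about [chi] being constant on the classes
    of [v]. *)
Lemma stable_factorisation G (I : finType) (v : vert G -> I) : stable P v all ->
  exists chi : vert G -> 'I_m, forall i, stable (Q i) v (fun x => chi x = i).
Proof.
move=> sP.
pose good B (_ : vert B -> vert G) (c : vert B -> 'I_m) :=
  forall i, hered (Q i) (fun x => c x = i).
have [||chi chiP] := @blowup_partition C G I v _ good.
- by move=> B B' p c f fE gB i; apply: hered_embed fE (gB i).
- by move=> B L p l b; apply/factor_colouring; apply: sP b _.
exists chi => i B L p l b pi; apply: (chiP _ _ _ _ b i B id) => //.
exact: embed_id.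
Qed.

(** * Existence of strict hypergraphs and the lower bound *)

Lemma exists_not_factor i : exists F, ~ Q i F.
Proof.
have [[G [_ nG] _] _] := Qind i; apply: contrapT => nF; apply: nG => H _.
by apply: contrapT => nQ; apply: nF; exists H.
Qed.

(* A colouring of the product of the vertex sets of the [F i] is onto
   [vert (F i)] in some colour [i]. *)
Lemma exists_not_product : exists H, ~ P H.
Proof.
apply: contrapT => nH; have aP H : P H.
  by apply: contrapT => nP; apply: nH; exists H.
have /choice[F nF] := exists_not_factor.
pose V : finType := {dffun forall i, vert (F i)}.
(* For the labelling [id] each vertex is a class by itself, so any hypergraph mapped injectively to
   [V] is a blow-up, whatever its edges. *)
have [|chi chiQ] := @stable_factorisation (edgeless C V) V id.
  by move=> B L p l _ _; apply: aP.
have [i /choice[g gP]] : exists i, forall x : vert (F i), exists y : V, chi y = i /\ y i = x.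
  apply: contrapT => nx.
  have xE i : exists x : vert (F i), forall y : V, chi y = i -> y i <> x.
    apply: contrapT => ni; apply: nx; exists i => x.
    apply: contrapT => nxy; apply: ni; exists x => y yi yx.
    by apply: nxy; exists y.
  (* The diagonal point: its coordinate at its own colour is a value which that colour misses. *)
  pose y : V := [ffun i => sval (cid (xE i))].
  by have := svalP (cid (xE (chi y))) y erefl; apply; rewrite ffunE.
have gI : injective g by move=> x y gxy; rewrite -(gP x).2 -(gP y).2 gxy.
apply: (nF i); apply: (chiQ i (F i) unit g (fun=> tt)) => [|x]; last by case: (gP x).
split=> [x y []/gI //|e _ vc|e _ _ x y _ _] //; split=> // /edges_wf[].
move: vc; case: (e.1) => [|x [|y s]] //= vc _.
by rewrite (gI x y) ?mem_head //; apply: vc; rewrite !inE eqxx ?orbT.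
Qed.

(** Vertices are deleted from a hypergraph outside [P] until the rest [G] lies in [P], at the latest
    when it is null. The last hypergraph outside [P] then belongs to [G * K1]. *)
Lemma exists_strict : exists G, strict P G.
Proof.
have [H] := exists_not_product; have [k] := ubnP #|vert H|.
elim: k H => // k IH H; rewrite ltnS => Hk nP.
have [/existsP[x _]|/existsPn nx] := boolP [exists x : vert H, true]; last first.
  case: nP; apply: (@induced_hereditary_embed _ P H (K0 C)
    (fun x => False_rect void (notF (nx x)))) Pprop.1 => //.
  split=> [x|e]; first by have := nx x.
  split=> // /edges_wf[]; case: (e.1) => // x; by have := nx x.
pose G := induced [set~ x]%SET.
have [PG|nPG] := pselect (P G); last first.
  apply: (IH G) => //; apply: leq_trans Hk.
  by rewrite /= card_sig cardsC1; case: #|vert H| (max_card (pred1 x)); rewrite ?card1.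
exists G; split=> // sP; apply: nP; apply: sP.
exists (fun b : bool => if b then [set~ x]%SET else [set x]%SET); split.
  split=> [y|[] [] y]; rewrite ?inE //; last first.
  - by move=> ->.
  - by move=> /negPf ->.
  by have [->|yx] := eqVneq y x; [exists false|exists true]; rewrite !inE.
case; last exact: iso_K1.
by exists id; split; [exists id|move=> e; rewrite map_edge_id].
Qed.

Lemma factor_K1 i : Q i (K1 C).
Proof.
have [[G [QG _] dG] _] := Qind i.
have [v [vs _]] := dec_at_stable (@Qadd i) (@Qher i) QG.
rewrite dG in v vs; have [x _] := vs ord0.
apply: (Qher (H := G)) QG; exists [set x]%SET.
exact: iso_sym (iso_K1 x).
Qed.

Lemma leq_dec_at_strict G : strict P G -> m <= dec_at P G.
Proof.
move=> sG; have [PG _] := sG; have /factor_colouring[chi chiQ] := PG.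
have chis i : exists x, chi x = i.
  (* An isolated vertex of colour [i] is added to [G]; by strictness its colour already occurs on
     [G]. *)
  pose F b := if b then G else K1 C.
  pose u b : vert (F b) -> 'I_m :=
    match b return vert (F b) -> 'I_m with true => chi | false => fun=> i end.
  have sF : stable P (fun y : vert (dunion F) => u (tag y) (tagged y)) all.
    apply: stable_colouring => j; apply: hered_dunion => // -[]; first exact: chiQ.
    by move=> B f fE _; apply: induced_hereditary_embed fE (factor_K1 j).
  have [y] := strict_surj sG (embed_Tagged F true) (fun=> I) sF
    (x := Tagged (fun b => vert (F b)) (tt : vert (F false))) I.
  by exists y.
have := leq_dec_at PG (stable_colouring chiQ).
rewrite (_ : [set chi x | x in predT]%SET = [set: 'I_m]%SET).
  by rewrite cardsT card_ord.
apply/finset.setP => i; rewrite inE; apply/imsetP.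
by have [x <-] := chis i; exists x.
Qed.

(** * The upper bound, from a strict hypergraph with fewest parts *)

Section Minimal.
Variable G0 : hypergraph C.
Hypotheses (sG0 : strict P G0)
  (G0min : forall G, strict P G -> dec_at P G0 <= dec_at P G).

Let n := dec_at P G0.
Let decomp G (v : vert G -> 'I_n) :=
  (forall j, exists x, v x = j) /\ stable P v all.

(** [G] is strict, so it has at least [n] parts by minimality. Each of its parts meets [G0], and
    restricting to [G0] shows that there are at most [n]. *)
Lemma exists_decomp G (g : vert G0 -> vert G) : embed g -> P G ->
  exists v : vert G -> 'I_n, decomp v.
Proof.
move=> gE PG; have [v [vs sv]] := dec_at_stable Padd Pher PG.
suff dG : dec_at P G = n by move: v vs sv; rewrite dG => v vs sv; exists v.
apply/eqP; rewrite eqn_leq G0min ?andbT; last exact: strict_embed gE PG.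
have := strict_leq sG0 gE (fun=> I) sv.
rewrite (_ : [set v (g y) | y in predT]%SET = [set: _]%SET) ?cardsT ?card_ord //.
apply/finset.setP => j; rewrite inE; apply/imsetP; have [x <-] := vs j.
by have [y yx] := strict_surj sG0 gE (fun=> I) sv (x := x) I; exists y.
Qed.

Lemma decomp_embed G H (g : vert G0 -> vert G) (f : vert G -> vert H)
    (v : vert H -> 'I_n) : embed g -> embed f -> decomp v -> decomp (v \o f).
Proof.
move=> gE fE [vs sv]; split; last exact: stable_embed sv.
move=> j; have [x <-] := vs j.
have [y <-] := strict_surj sG0 (embed_comp gE fE) (fun=> I) sv (x := x) I.
by exists (g y).
Qed.

(* A common refinement with an [n]-part decomposition has at most [n] parts. *)
Lemma refine_factor G (g : vert G0 -> vert G) (I : finType) (a : vert G -> I)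
    (v : vert G -> 'I_n) : embed g -> (forall j, exists x, v x = j) ->
  stable P (fun x => (a x, v x)) all ->
  exists s : 'I_n -> I, forall x, a x = s (v x).
Proof.
move=> gE vs sav; pose S := [set (a x, v x) | x in predT]%SET.
have SI : {in S &, injective snd}.
  apply/imset_injP; rewrite eqn_leq leq_imset_card /=.
  rewrite (_ : [set x.2 | x in S]%SET = [set: 'I_n]%SET); last first.
    apply/finset.setP => j; rewrite inE; have [x <-] := vs j.
    by apply/imsetP; exists (a x, v x) => //; apply/imsetP; exists x.
  rewrite cardsT card_ord; apply: leq_trans (strict_leq sG0 gE (fun=> Logic.I) sav).
  apply/subset_leq_card/fintype.subsetP => _ /imsetP[x _ ->].
  have [y <-] := strict_surj sG0 gE (fun=> Logic.I) sav (x := x) Logic.I.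
  by apply/imsetP; exists y.
have /choice[r rP] := vs; exists (a \o r) => x /=.
have xS z : (a z, v z) \in S by apply/imsetP; exists z.
by have [] := SI _ _ (xS x) (xS (r (v x))) (esym (rP (v x))).
Qed.

(** Blow-ups of [u] are coloured by restrictions of decompositions. The partition theorem gives one
    [v] on [G] that works for all of them, [stable_refine] makes the pair of [u] and [v] stable, and
    [refine_factor] makes [u] a function of [v]. *)
Lemma respecting_decomp G (g : vert G0 -> vert G) (u : vert G -> 'I_m) :
  embed g -> (forall i, hered (Q i) (fun x => u x = i)) ->
  exists2 v : vert G -> 'I_n, decomp v &
    exists s : 'I_n -> 'I_m, forall x, u x = s (v x).
Proof.
move=> gE hQ; have su := stable_colouring hQ.
pose good B (_ : vert B -> vert G) (c : vert B -> 'I_n) :=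
  exists H (f : vert B -> vert H) (w : vert H -> 'I_n),
    [/\ embed f, decomp w & forall y, c y = w (f y)].
have [||v vP] := @blowup_partition C G _ u _ good.
- move=> B B' p c f fE [H [h [w [hE dw cw]]]].
  exists H, (h \o f), w; split=> // [|y /=]; first exact: embed_comp.
  exact: cw.
(* [B] need not contain [G0], so a copy of [G] is placed beside it. *)
- move=> B L p l b; pose F x := if x then B else G.
  pose p' x : vert (F x) -> vert G :=
    match x return vert (F x) -> vert G with true => p | false => id end.
  pose L' (x : bool) : finType := if x then L else unit.
  pose l' x : vert (F x) -> L' x :=
    match x return vert (F x) -> L' x with true => l | false => fun=> tt end.
  have b' x : blowup u (p' x) (l' x) by case: x => //; apply: blowup_id.
  have PF : P (dunion F) by apply: su (blowup_dunion b') _.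
  have [w dw] := exists_decomp (embed_comp gE (embed_Tagged F false)) PF.
  exists (fun y => w (Tagged (fun x => vert (F x)) (y : vert (F true)))).
  exists (dunion F), (fun y => Tagged (fun x => vert (F x)) (y : vert (F true))), w.
  by split=> //; apply: (embed_Tagged F true).
have dv : decomp v.
  have [H [f [w [fE dw cw]]]] := vP _ _ _ _ (blowup_id u).
  rewrite (_ : v = w \o f); last by apply/funext => y; apply: cw.
  exact: decomp_embed gE fE dw.
exists v => //; apply: (refine_factor gE dv.1).
apply: stable_refine => B L p l /vP[H [f [w [fE [_ sw] cw]]]].
by exists H, f, w.
Qed.

(** The groupings of parts into factors, as finite functions so that they can be counted. *)
Let groupings G (v : vert G -> 'I_n) : {set {ffun 'I_n -> 'I_m}} :=
  [set s : {ffun 'I_n -> 'I_m} |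
    `[< forall i, stable (Q i) v (fun x => s (v x) = i) >]]%SET.

Lemma exists_grouping G (g : vert G0 -> vert G) (v : vert G -> 'I_n) :
  embed g -> decomp v -> exists s, s \in groupings v.
Proof.
move=> gE [vs sv]; have [chi chiQ] := stable_factorisation sv.
have [s sE] := refine_factor gE vs (stable_factors chiQ).
exists [ffun j => s j]; rewrite inE; apply/asboolP => i.
rewrite (_ : (fun x => _) = (fun x => chi x = i)) //.
by apply/funext => x; rewrite ffunE sE.
Qed.

Lemma groupings_embed G H (f : vert G -> vert H) (v : vert H -> 'I_n) :
  embed f -> groupings v \subset groupings (v \o f).
Proof.
move=> fE; apply/fintype.subsetP => s; rewrite !inE => /asboolP sv.
by apply/asboolP => i; apply: stable_embed (sv i).
Qed.

(** Beside each blow-up of [v] one places [G] and all [F i], coloured by factors according to [s]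
    and [i], and takes a decomposition respecting these colours. The partition theorem picks a
    pattern [xi] on [G], which turns out to be [v] up to renaming the parts. *)
Lemma extend_decomp (F : 'I_m -> hypergraph C) G (g : vert G0 -> vert G)
    (v : vert G -> 'I_n) s :
  (forall i, Q i (F i)) -> embed g -> decomp v -> s \in groupings v ->
  exists H (f : vert G -> vert H) (w : vert H -> 'I_n),
    [/\ embed f, decomp w, forall x, v x = w (f x) &
      forall i, exists2 h : vert (F i) -> vert H, embed h & forall y, s (w (h y)) = i].
Proof.
move=> QF gE dv; rewrite inE => /asboolP sv.
pose good B (p : vert B -> vert G) (c : vert B -> 'I_n) :=
  exists H (f : vert B -> vert H) (w : vert H -> 'I_n) (t : 'I_n -> 'I_m),
    [/\ embed f, decomp w, forall y, c y = w (f y),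
      forall y, s (v (p y)) = t (w (f y)) &
      forall i, exists2 h : vert (F i) -> vert H, embed h & forall y, t (w (h y)) = i].
have [||xi xiP] := @blowup_partition C G _ v _ good.
- move=> B B' p c f fE [H [h [w [t [hE dw cw cs cF]]]]].
  exists H, (h \o f), w, t; split=> // [|y /=|y /=]; first exact: embed_comp.
    exact: cw.
  exact: cs.
- move=> B L p l b.
  pose K (x : option (option 'I_m)) : hypergraph C :=
    match x with None => B | Some None => G | Some (Some i) => F i end.
  pose u x : vert (K x) -> 'I_m :=
    match x return vert (K x) -> 'I_m with
    | None => fun y => s (v (p y)) | Some None => fun y => s (v y)
    | Some (Some i) => fun=> i end.
  pose T x (y : vert (K x)) : vert (dunion K) := Tagged (fun x => vert (K x)) y.
  have TE x : embed (@T x) by apply: embed_Tagged.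
  pose U (y : vert (dunion K)) := u (tag y) (tagged y).
  have hU i : hered (Q i) (fun y => U y = i).
    apply: hered_dunion => // -[[j|]|] X f fE fi.
    - have [[x _]|nx] := pselect (exists x : vert X, True).
        rewrite -(fi x); exact: induced_hereditary_embed fE (QF j).
      have nX (x : vert X) : unit by [].
      apply: (@induced_hereditary_embed _ (Q i) X (K1 C) nX) (factor_K1 i) => //.
      split=> [x|e]; first by case: nx; exists x.
      by split=> // /edges_wf[]; case: (e.1) => // x; case: nx; exists x.
    - exact: (sv i X unit f _ (blowup_embed (blowup_id v) fE)).
    - exact: (sv i X L _ _ (blowup_embed b fE)).
  have [w dw [t tE]] := respecting_decomp (embed_comp gE (TE (Some None))) hU.
  exists (w \o @T None), (dunion K), (@T None), w, t.
  split=> // [|y|i]; [exact: (TE None)|by rewrite -tE|].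
  by exists (@T (Some (Some i))) => [|y]; [exact: (TE (Some (Some i)))|rewrite -tE].
have [H [f [w [t [fE dw xw st tF]]]]] := xiP _ _ _ _ (blowup_id v).
have dxi : decomp xi.
  rewrite (_ : xi = w \o f); last by apply/funext => y; apply: xw.
  exact: decomp_embed gE fE dw.
have [|r rE] := refine_factor gE dxi.1 (a := v).
  apply: stable_refine => B L p l /xiP[H' [f' [w' [t' [fE' [_ sw'] cw' _ _]]]]].
  by exists H', f', w'.
have /choice[z zP] := dv.1.
(* [v] and [xi] both use all [n] labels, so [r] is a bijection and [r \o w] is [w] with its parts
   renamed to match [v]. *)
have rK : cancel (xi \o z) r by move=> j /=; rewrite -rE zP.
have sr j : s (r j) = t j.
  by have [x <-] := dxi.1 j; rewrite -rE (st x); congr t; rewrite -(xw x).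
exists H, f, (r \o w); split=> //.
- split=> [j|].
    by have [x wx] := dw.1 (xi (z j)); exists x; rewrite /= wx [LHS]rK.
  apply: stable_kernel dw.2 => x y _ _; split=> [/= -> //|].
  by move/(can_inj (canF_sym rK)).
- by move=> x; rewrite rE; congr r; apply: xw.
by move=> i; have [h hE hi] := tF i; exists h => // y; rewrite /= sr.
Qed.

Lemma leq_factors : n <= m.
Proof.
pose good k := exists G (g : vert G0 -> vert G) (v : vert G -> 'I_n),
  [/\ embed g, decomp v & #|groupings v| = k].
have ex_good : exists k, `[< good k >].
  have [v dv] := exists_decomp (embed_id G0) sG0.1.
  by exists #|groupings v|; apply/asboolP; exists G0, id, v; split=> //; apply: embed_id.
case: (ex_minnP ex_good) => k /asboolP[G [g [v [gE dv kE]]]] kmin.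
have [s sv] := exists_grouping gE dv.
have /choice[F FP] : forall i, exists F, strict (Q i) F /\ dec_at (Q i) F = 1.
  by move=> i; have [[F sF dF] _] := Qind i; exists F.
have [i|H [f [w [fE dw vw hF]]]] := extend_decomp (F := F) _ gE dv sv.
  by case: (FP i) => [[]].
(* Every grouping of [w] restricts to one of [v], and by minimality there are no fewer of them, so
   none was lost. *)
have sw : s \in groupings w.
  suff /eqP -> : groupings w == groupings v by [].
  have vE : v = w \o f by apply/funext => x; rewrite vw.
  rewrite eqEcard {1}vE groupings_embed //= kE; apply: kmin; apply/asboolP.
  by exists H, (f \o g), w; split=> //; apply: embed_comp.
move: sw; rewrite inE => /asboolP sw.
(* [F i] is [Q i]-strict, so it meets every part grouped into [i]; as its own decompositions have at
   most one part, there is at most one such part. *)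
have wc i x y : s (w x) = i -> s (w y) = i -> w x = w y.
  move=> xi yi; have [[sF dF] [h hE hi]] := (FP i, hF i).
  have := strict_leq sF hE hi (sw i); rewrite dF => /card_le1P le1.
  have [x' <-] := strict_surj sF hE hi (sw i) xi.
  have [y' <-] := strict_surj sF hE hi (sw i) yi.
  have xS z : w (h z) \in [set w (h y) | y in predT]%SET by apply/imsetP; exists z.
  by have := le1 _ (xS x') (w (h y')); rewrite xS => /esym; rewrite inE => /eqP ->.
suff sI : injective s by have := leq_card s sI; rewrite !card_ord.
move=> j j' jj; have [[x xj] [y yj]] := (dw.1 j, dw.1 j').
by rewrite -xj -yj; apply: (wc (s j)); rewrite ?xj ?yj.
Qed.

End Minimal.

Lemma is_dec_factorisation : is_dec P m.
Proof.
pose good k := exists2 G, strict P G & dec_at P G = k.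
have ex_good : exists k, `[< good k >].
  by have [G sG] := exists_strict; exists (dec_at P G); apply/asboolP; exists G.
case: (ex_minnP ex_good) => k /asboolP[G sG dG] kmin; split; last exact: leq_dec_at_strict.
exists G => //; apply/eqP; rewrite eqn_leq leq_dec_at_strict // andbT.
apply: leq_factors => // H sH; rewrite dG; apply: kmin.
by apply/asboolP; exists H.
Qed.

End Factorisation.

Theorem theorem3 (C : Type) (P : hclass C) (m : nat)
    (Q : 'I_m -> hclass C)
    (Pprop : is_property P) (Padd : additive P) (Pher : induced_hereditary P)
    (Qprop : forall i, is_property (Q i))
    (Qadd : forall i, additive (Q i))
    (Qher : forall i, induced_hereditary (Q i))
    (Qind : forall i, indecomposable (Q i))
    (PQ : forall H, P H <-> circ Q H) :
  is_dec P m.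
Proof. exact: (is_dec_factorisation Pprop Padd Pher Qadd Qher Qind PQ). Qed.
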